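(* Let $n\geq 1$ and let $(\xi_1,\ldots,\xi_n)$ be a vector of real random variables whose law $\mathbf{P}$ is exchangeable and sign-invariant. Let $S_0=0$, $S_k=\sum_{i=1}^k \xi_i$ for $1\leq k\leq n$, and let $g(n)=\frac{1}{4^n}\binom{2n}{n}$. Then $$\mathbf{P}\big(S_k>0 \text{ for all } 1\leq k\leq n\big)\ \leq\ g(n)\ \leq\ \mathbf{P}\big(S_k\geq 0 \text{ for all } 1\leq k\leq n\big).$$ Notably, if $\mathbf{P}$ has no atom, then $$\mathbf{P}\big(S_k>0 \text{ for all } 1\leq k\leq n\big)=g(n)=\mathbf{P}\big(S_k\geq 0 \text{ for all } 1\leq k\leq n\big).$$
   Context: $\mathbf{P}$ denotes the law of the vector $(\xi_1,\ldots,\xi_n)$. It is called exchangeable if for every permutation $\sigma$ of $\{1,\ldots,n\}$ the vector $(\xi_{\sigma(1)},\ldots,\xi_{\sigma(n)})$ has the same distribution as $(\xi_1,\ldots,\xi_n)$. It is called sign-invariant if for every $\varepsilon=(\varepsilon_1,\ldots,\varepsilon_n)\in\{-1,1\}^n$ the vector $(\varepsilon_1\xi_1,\ldots,\varepsilon_n\xi_n)$ has the same distribution as $(\xi_1,\ldots,\xi_n)$. No independence of the $\xi_i$ is assumed.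
   Formalization: In the last sentence, ''P has no atom'' is replaced by P(S_k = 0) = 0 for all 1 ≤ k ≤ n, since the equality fails for the atomless law of (e_1 U, e_2 U) with U uniform on [0,1] and independent fair signs e_1, e_2. *)

(* Defs.v *)
From HB Require Import structures.
From mathcomp Require Import all_boot all_order all_algebra all_fingroup.
From mathcomp Require Import all_classical all_reals all_analysis.

Set Implicit Arguments.
Unset Strict Implicit.
Unset Printing Implicit Defensive.

Import Order.TTheory GRing.Theory Num.Theory.
Local Open Scope classical_set_scope.
Local Open Scope ring_scope.

(* The law on [R^n] of the vector [(xi_0, ..., xi_(n-1))]; [n.-tuple R] carries
   the product of the Borel sigma-algebras. *)
Definition joint_law (d : measure_display) (T : measurableType d)
    (R : realType) (P : probability T R) (n : nat) (xi : 'I_n -> T -> R) :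
    set (n.-tuple R) -> \bar R :=
  pushforward P (fun w => [tuple xi i w | i < n]).

Definition same_law (d : measure_display) (T : measurableType d)
    (R : realType) (P : probability T R) (n : nat) (xi zeta : 'I_n -> T -> R) :
    Prop :=
  forall A : set (n.-tuple R), measurable A ->
    joint_law P xi A = joint_law P zeta A.

Definition exchangeable (d : measure_display) (T : measurableType d)
    (R : realType) (P : probability T R) (n : nat) (xi : 'I_n -> T -> R) :
    Prop :=
  forall s : 'S_n, same_law P (fun i => xi (s i)) xi.

Definition sign_invariant (d : measure_display) (T : measurableType d)
    (R : realType) (P : probability T R) (n : nat) (xi : 'I_n -> T -> R) :
    Prop :=
  forall e : 'I_n -> R, (forall i, e i = 1 \/ e i = -1) ->
    same_law P (fun i w => e i * xi i w) xi.

(* Indices start at 0, so [S_k] is the sum of the [xi i] with [i < k]; only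
   [k <= n] is meaningful. *)
Definition partial_sum (T : Type) (R : realType) (n : nat)
    (xi : 'I_n -> T -> R) (k : nat) (w : T) : R :=
  \sum_(i < n | (i < k)%N) xi i w.

Definition central_ratio (R : realType) (n : nat) : R :=
  'C(n.*2, n)%:R / 4 ^+ n.

(* Atomlessness of the joint law on [R^n], or of each [xi i], would not make the
   strict and the large persistence probabilities agree: if [U] is uniform on
   [0, 1] and [e_1], [e_2] are independent fair signs, also independent of [U],
   then [(e_1 U, e_2 U)] has no atom, but its partial sum [S_2] vanishes with
   probability 1/2, and the two probabilities are 1/4 and 1/2.  The laws in which
   atoms matter are those of the partial sums, and the only atom that matters
   is 0. *)
Definition partial_sums_no_atom0 (d : measure_display) (T : measurableType d)
    (R : realType) (P : probability T R) (n : nat) (xi : 'I_n -> T -> R) :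
    Prop :=
  forall k : nat, (1 <= k <= n)%N ->
    pushforward P (partial_sum xi k) [set 0] = 0%E.

(* Main.v *)
(* Fix a vector [x] and draw a uniform signed permutation of its entries.  If the
   partial sums are pairwise distinct, the path has a unique minimum, at some
   [k].  The path after [k] stays above its starting point; so does the path
   before [k], once reversed and negated.  As the law is invariant under such
   reversals of blocks, the probability [g n] of staying positive satisfies
   [\sum_k g k * g (n - k) = 1], which characterises ['C(2n, n) / 4 ^ n].  Only
   the relative order of the partial sums matters, so ties are broken
   lexicographically; a path with positive (resp. nonnegative) partial sums is
   counted less (resp. more) often.  Averaging over all signed permutations and
   integrating with respect to [P] gives the theorem. *)

Require Import Defs.
From mathcomp Require Import all_boot all_order all_algebra all_fingroup.
From mathcomp Require Import all_classical all_reals all_analysis.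
From mathcomp Require Import measurable_realfun.
From mathcomp Require Import zify ring lra.

Set Implicit Arguments.
Unset Strict Implicit.

Import Order.TTheory GRing.Theory Num.Theory.
Local Open Scope classical_set_scope.
Local Open Scope ring_scope.

(** * Recurrence and convolution identity for the central binomial ratios *)

Lemma central_ratio0 (R : realType) : central_ratio R 0 = 1.
Proof. by rewrite /central_ratio bin0 expr0 divr1. Qed.

Lemma central_ratioS (R : realType) (n : nat) :
  n.+1.*2%:R * central_ratio R n.+1 = n.*2.+1%:R * central_ratio R n.
Proof.
have e1 : (n.+1 * 'C(n.+1.*2, n.+1) = (n.*2.+1).*2 * 'C(n.*2, n))%N.
  have e1 := mul_bin_diag n.+1.*2 n; have e2 := mul_bin_down n.*2.+1 n.
  rewrite -e1 doubleS /=; rewrite /= (_ : n.*2.+1 - n = n.+1)%N in e2; last lia.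
  by rewrite -doubleS -doubleMl -e2 doubleMl.
have e2 : n.+1%:R * 'C(n.+1.*2, n.+1)%:R = 2 * (n.*2.+1)%:R * 'C(n.*2, n)%:R :> R.
  by rewrite -natrM e1 -mul2n !natrM.
rewrite /central_ratio exprS -[n.+1.*2 in X in X * _]mul2n natrM.
have -> : 2 * n.+1%:R * ('C(n.+1.*2, n.+1)%:R / (4 * 4 ^+ n)) =
  2 / 4 * (n.+1%:R * 'C(n.+1.*2, n.+1)%:R) / 4 ^+ n :> R.
  by field; rewrite expf_neq0 ?pnatr_eq0.
by rewrite e2; field; rewrite expf_neq0 ?pnatr_eq0.
Qed.

(* Symmetrising [k <-> n - k] turns the weight [2 k] into [n]; the recurrence
   of [central_ratioS] then reduces the convolution of rank [n.+1] to that of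
   rank [n]. *)
Lemma central_ratio_conv (R : realType) (n : nat) :
  \sum_(k < n.+1) central_ratio R k * central_ratio R (n - k) = 1.
Proof.
set g := central_ratio R.
have sym (m : nat) : \sum_(k < m.+1) k.*2%:R * (g k * g (m - k)%N) =
    m%:R * \sum_(k < m.+1) g k * g (m - k)%N.
  rewrite mulr_sumr.
  have -> : \sum_(k < m.+1) k.*2%:R * (g k * g (m - k)%N) =
     \sum_(k < m.+1) k%:R * (g k * g (m - k)%N) +
     \sum_(k < m.+1) k%:R * (g k * g (m - k)%N).
    by rewrite -big_split; apply: eq_bigr => k _; rewrite -addnn natrD mulrDl.
  rewrite [X in _ + X](reindex_inj rev_ord_inj) -big_split /=.
  apply: eq_bigr => k _; have kn := ltn_ord k.
  rewrite subSS subKn //.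
  have -> : m%:R = k%:R + (m - k)%:R :> R by rewrite -natrD subnKC.
  rewrite mulrDl.
  by congr (_ + _); congr (_ * _); rewrite mulrC.
elim: n => [|n IH]; first by rewrite big_ord1 /g !central_ratio0 mulr1.
apply: (@mulfI _ n.+1%:R); first by rewrite pnatr_eq0.
rewrite -sym big_ord_recl mul0r add0r mulr1.
under eq_bigr => k _ do rewrite mulrA central_ratioS /= subSS -mulrA.
under eq_bigr => k _ do rewrite -natr1 mulrDl mul1r.
by rewrite big_split /= -/g sym IH -natr1 !mulr1.
Qed.

(** * Counting the position of the minimum by block reversals *)

(** An injective self-map of a finite set [D] permutes [D], so it carries one of the two subsets
    bijectively onto the other. *)
Lemma card_closed (W : finType) (D : {set W}) (f : W -> W) (p : pred W) :
  injective f -> (forall w, w \in D -> f w \in D) ->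
  #|[set w in D | p (f w)]| = #|[set w in D | p w]|.
Proof.
move=> f_inj fD.
have fDD : (f @: D = D)%SET.
  apply/eqP; rewrite eqEcard (card_imset _ f_inj) leqnn andbT.
  by apply/fintype.subsetP => _ /imsetP[w wD ->]; exact: fD.
rewrite -(card_imset _ f_inj); congr #|pred_of_set _|; apply/setP => v.
apply/imsetP/idP => [[w]|]; rewrite !inE.
  by move=> /andP[wD pw] ->; rewrite pw fD.
rewrite -{1}fDD => /andP[/imsetP[w wD ->] pw].
by exists w; rewrite // inE wD.
Qed.

(* [h a b] stands for the reversal of the block [[a, b]], under the central
   symmetry that keeps its left end in place: it reverses the order on the block
   and does not touch what precedes it.  Reversing [[a, c]] exchanges "[c] is the
   minimum of [[a, c]]" and "[a] is the minimum of [[a, c]]". *)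
Section BlockReversal.
Variables (R : realType) (W : finType) (n : nat).
Variables (lt : W -> rel nat) (h : nat -> nat -> W -> W).
Hypothesis lt_irr : forall w, irreflexive (lt w).
Hypothesis lt_tr : forall w, transitive (lt w).
Hypothesis lt_total : forall w i j,
  (i <= n)%N -> (j <= n)%N -> i != j -> lt w i j || lt w j i.
Hypothesis h_inj : forall a b, (a <= b <= n)%N -> injective (h a b).
Hypothesis h_in : forall a b w i j, (a <= b <= n)%N ->
  (a <= i <= b)%N -> (a <= j <= b)%N ->
  lt (h a b w) i j = lt w (a + b - i)%N (a + b - j)%N.
Hypothesis h_before : forall a b w i j, (a <= b <= n)%N ->
  (i <= a)%N -> (j <= a)%N -> lt (h a b w) i j = lt w i j.

Definition ismin (w : W) (a b c : nat) : bool :=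
  [forall i : 'I_n.+1, (a <= i <= b)%N && (i != c :> nat) ==> lt w c i].

Lemma isminP (w : W) (a b c : nat) : (b <= n)%N ->
  reflect (forall i, (a <= i <= b)%N -> i != c -> lt w c i) (ismin w a b c).
Proof.
move=> bn; apply: (iffP forallP) => [H i ib ic|H i].
  have ilt : (i < n.+1)%N by lia.
  by have /implyP := H (Ordinal ilt); apply; rewrite /= ib.
by apply/implyP => /andP[]; exact: H.
Qed.

Lemma ismin_exists (w : W) (a b : nat) : (a <= b <= n)%N ->
  exists2 c, (a <= c <= b)%N & ismin w a b c.
Proof.
elim: b => [|b IH] abn.
  by exists 0%N; [lia|apply/isminP => // i ib ic; lia].
have [ab|ab] := leqP a b; last first.
  by exists b.+1; [lia|apply/isminP => [|i ib ic]; lia].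
have bn : (b <= n)%N by lia.
have [|c cb /(isminP _ _ _ bn) cmin] := IH; first by lia.
have /orP[lc|lb] : lt w c b.+1 || lt w b.+1 c by apply: lt_total; lia.
  exists c; first by lia.
  apply/isminP => [|i ib ic]; first lia.
  by have [->//|ib'] := eqVneq i b.+1; apply: cmin => //; lia.
exists b.+1; first by lia.
apply/isminP => [|i ib ic]; first lia.
have [->//|ic'] := eqVneq i c.
by apply: lt_tr lb _; apply: cmin => //; lia.
Qed.

Lemma ismin_unique (w : W) (a b c e : nat) : (b <= n)%N ->
  (a <= c <= b)%N -> (a <= e <= b)%N ->
  ismin w a b c -> ismin w a b e -> c = e.
Proof.
move=> bn cb eb /(isminP _ _ _ bn) cm /(isminP _ _ _ bn) em.
apply/eqP/negPn/negP => ce.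
have := lt_tr (cm e eb _) (em c cb ce).
by rewrite lt_irr eq_sym => /(_ ce).
Qed.

(** Double counting: each [w] has exactly one minimum on the block, so it is counted for exactly one
    [c]. *)
Lemma sum_ismin (D : {set W}) (a m : nat) : (a + m <= n)%N ->
  (\sum_(c < m.+1) #|[set w in D | ismin w a (a + m)%N (a + c)%N]| = #|D|)%N.
Proof.
move=> amn.
under eq_bigr => c _ do rewrite -sum1_card.
under eq_bigr => c _ do (under eq_bigl => w do rewrite inE).
under eq_bigr => c _ do rewrite big_mkcondr.
rewrite exchange_big /= -sum1_card; apply: eq_bigr => w _.
have [|c cb cm] := @ismin_exists w a (a + m); first lia.
have clt : (c - a < m.+1)%N by lia.
have ce : (a + (c - a) = c)%N by lia.
rewrite (bigD1 (Ordinal clt)) //= ce cm big1 // => e ne.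
case: ifP => // em; case/eqP: ne; apply: val_inj => /=.
have := ismin_unique amn cb _ cm em; have := ltn_ord e; lia.
Qed.

Lemma ismin_split (w : W) (a b c : nat) : (b <= n)%N -> (a <= c <= b)%N ->
  ismin w a b c = ismin w a c c && ismin w c b c.
Proof.
move=> bn cb; have cn : (c <= n)%N by lia.
apply/(isminP _ _ _ bn)/andP => [H|[/(isminP _ _ _ cn) H1 /(isminP _ _ _ bn) H2] i ib ic].
  by split; apply/isminP => // i ib; apply: H; lia.
by have [ic'|ic'] := leqP i c; [apply: H1|apply: H2] => //; lia.
Qed.

Lemma ismin_reverse (w : W) (a c : nat) : (a <= c <= n)%N ->
  ismin (h a c w) a c a = ismin w a c c.
Proof.
move=> acn; have cn : (c <= n)%N by lia.
apply/(isminP _ _ _ cn)/(isminP _ _ _ cn) => H i ib ic.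
  have := H (a + c - i)%N; rewrite h_in //; try lia.
  have -> : (a + c - a = c)%N by lia.
  have -> : (a + c - (a + c - i) = i)%N by lia.
  by apply; lia.
rewrite h_in //; try lia.
have -> : (a + c - a = c)%N by lia.
by apply: H; lia.
Qed.

(** Strong induction on the length [m] of the block. [D] is arbitrary, subject only to stability
    under reversals inside the block, because the induction hypothesis is also applied to a subset
    of [D] cut out by a condition on an earlier block. *)
Lemma card_ismin_left (m a : nat) (D : {set W}) : (a + m <= n)%N ->
  (forall c d w, (a <= c <= d)%N -> (d <= a + m)%N -> w \in D -> h c d w \in D) ->
  #|[set w in D | ismin w a (a + m)%N a]|%:R = central_ratio R m * #|D|%:R.
Proof.
elim/ltn_ind: m a D => m IH a D amn hD.
case: m => [|m] in IH amn hD *.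
  rewrite central_ratio0 mul1r; congr (_%:R); congr #|pred_of_set _|.
  apply/setP => w; rewrite inE; case: (w \in D) => //=.
  by apply/isminP => [|i]; lia.
set b := (a + m.+1)%N in amn hD *.
have left_eq (c : nat) : (a <= c <= b)%N ->
    #|[set w in D | ismin w a c c]| = #|[set w in D | ismin w a c a]|.
  move=> cb; rewrite -(@card_closed _ D (h a c) (fun w => ismin w a c a)).
  - by congr #|pred_of_set _|; apply/setP => w; rewrite !inE ismin_reverse; last lia.
  - by apply: h_inj; lia.
  - by move=> w; apply: hD; lia.
have mid (c : nat) : (0 < c < m.+1)%N ->
    #|[set w in D | ismin w a b (a + c)%N]|%:R =
    central_ratio R c * central_ratio R (m.+1 - c) * #|D|%:R :> R.
  move=> cm.
  (* The condition on the left of [a + c] is absorbed into the set. That set is still stable under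
     reversals inside the right block, since these leave the path up to [a + c] in the same order;
     the induction hypothesis thus applies first on the right, then on the left. *)
  have -> : [set w in D | ismin w a b (a + c)%N]%SET =
      [set w in [set w in D | ismin w a (a + c)%N (a + c)%N] |
         ismin w (a + c)%N (a + c + (m.+1 - c))%N (a + c)%N]%SET.
    apply/setP => w; rewrite !inE (@ismin_split w a b (a + c)); try lia.
    by rewrite -andbA /b -addnA subnKC //; lia.
  rewrite IH; try lia; last first.
    move=> p q w pq qb; rewrite !inE => /andP[wD wm].
    rewrite hD; try lia; rewrite //=.
    apply/isminP => [|i ib ic]; first lia.
    rewrite h_before; try lia.
    by move/isminP: wm; apply; lia.
  rewrite left_eq; last lia.
  rewrite IH; try lia; first by rewrite mulrA [X in X * _]mulrC.
  by move=> p q w pq qb; apply: hD; lia.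
(* The induction hypothesis misses the two extreme positions of the minimum, but reversing the whole
   block shows that their counts are equal. The convolution identity has two equal extreme terms as
   well, with the same middle terms up to the factor [#|D|]; comparing the two totals gives the
   unknown count. *)
have := central_ratio_conv R m.+1; have := sum_ismin D amn.
rewrite big_ord_recl big_ord_recr addn0 -/b left_eq; last lia.
move=> /(congr1 (fun k : nat => k%:R : R)); rewrite !natrD natr_sum.
rewrite (eq_bigr (fun c : 'I_m => central_ratio R c.+1 *
  central_ratio R (m.+1 - c.+1) * #|D|%:R)); last first.
  by move=> [c cm] _; rewrite lift0 /= mid //; lia.
rewrite -mulr_suml big_ord_recl big_ord_recr /= => tot.
rewrite subn0 /bump leq0n add1n subnn central_ratio0 mul1r mulr1.
rewrite [X in _ + (X + _)](eq_bigr (fun c : 'I_m => central_ratio R c.+1 *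
  central_ratio R (m.+1 - c.+1))) => [conv|//].
by move: tot conv; set s := \sum_(c < m) _; set N := #|_|%:R; nra.
Qed.

End BlockReversal.

(** * Signed permutations, their paths and the breaking of ties *)

(** A 2-adic argument: the smallest exponent [f k] occurs once, and all other terms are divisible by
    [2 ^+ (f k).+1]. *)
Lemma signed_pow2_neq0 (I : finType) (P : pred I) (e : I -> bool) (f : I -> nat)
    (i0 : I) : P i0 -> injective f ->
  \sum_(i | P i) (-1) ^+ e i * 2 ^+ f i != 0 :> int.
Proof.
move=> Pi0 f_inj; case: (arg_minnP f Pi0) => k Pk kmin.
rewrite (bigD1 k) //= addr_eq0; apply/eqP => sum_eq.
have : (2 ^+ (f k).+1 %| (-1) ^+ e k * 2 ^+ f k)%Z.
  rewrite sum_eq rpredN; apply: rpred_sum => i /andP[Pi ik].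
  apply/dvdz_mull/dvdz_exp2l; rewrite ltn_neqAle kmin // andbT.
  by apply: contra ik => /eqP/f_inj ->.
by rewrite dvdzE abszMsign !abszX dvdn_Pexp2l // ltnn.
Qed.

Section SignedPermutations.
Variable n : nat.

(** Index [i] is the step from time [i] to time [i.+1], so reversing the times from [a] to [b] sends
    it to [a + b - i - 1]. The test [b <= n] makes the map an involution for all [a] and [b], whence
    a permutation without side condition. *)
Definition block_rev_fun (a b : nat) (i : 'I_n) : 'I_n :=
  if (a <= i < b)%N && (b <= n)%N then insubd i (a + b - i).-1%N else i.

Lemma val_block_rev_fun (a b : nat) (i : 'I_n) : (b <= n)%N ->
  block_rev_fun a b i = (if (a <= i < b)%N then (a + b - i).-1 else i)%N :> nat.
Proof.
move=> bn; rewrite /block_rev_fun bn andbT; case: ifP => // ib.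
by rewrite val_insubd ifT //; lia.
Qed.

Lemma block_rev_funK (a b : nat) : involutive (block_rev_fun a b).
Proof.
move=> i; have [bn|bn] := leqP b n; last first.
  by rewrite /block_rev_fun (leqNgt b) bn !andbF.
apply: val_inj; rewrite /= !val_block_rev_fun //.
by case: (ifP (a <= i < b)%N) => ib; case: ifP; lia.
Qed.

Definition block_rev (a b : nat) : 'S_n := perm (inv_inj (block_rev_funK a b)).

Lemma val_block_rev (a b : nat) (i : 'I_n) : (b <= n)%N ->
  block_rev a b i = (if (a <= i < b)%N then (a + b - i).-1 else i)%N :> nat.
Proof. by move=> bn; rewrite permE val_block_rev_fun. Qed.

Lemma block_revK (a b : nat) : involutive (block_rev a b).
Proof. by move=> i; rewrite !permE block_rev_funK. Qed.

Definition signed_perm := ('S_n * {ffun 'I_n -> bool})%type.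

Definition signed_path (K : pzRingType) (v : 'I_n -> K) (w : signed_perm)
    (k : nat) : K :=
  \sum_(i < n | (i < k)%N) (-1) ^+ w.2 i * v (w.1 i).

(* Reversing the order of the steps of a block and changing their signs acts on
   the path by a central symmetry of that block. *)
Definition block_flip (a b : nat) (w : signed_perm) : signed_perm :=
  ((block_rev a b * w.1)%g,
   [ffun i : 'I_n => (a <= i < b)%N (+) w.2 (block_rev a b i)]).

Lemma block_flip_inj (a b : nat) : (b <= n)%N -> injective (block_flip a b).
Proof.
move=> bn; apply: inv_inj => -[s e]; rewrite /block_flip /=; congr pair.
  by apply/permP => i; rewrite !permM block_revK.
apply/ffunP => i; rewrite !ffunE /= block_revK val_block_rev //.
by case: ifP => ib; case: (e i); lia.
Qed.

Section Path.
Variables (K : pzRingType) (v : 'I_n -> K).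

(** On the block, the new path is the old one read backwards in time, translated so as to keep its
    value at [a]; comparisons do not see the translation. The ring [K] is general so as to cover
    both the real path and the integer path [tie_path]. *)
Lemma signed_path_flip (a b : nat) (w : signed_perm) (j : nat) :
  (b <= n)%N -> (a <= j <= b)%N ->
  signed_path v (block_flip a b w) j =
  signed_path v w a - signed_path v w b + signed_path v w (a + b - j).
Proof.
move=> bn jb; rewrite /signed_path (reindex_inj (@perm_inj _ (block_rev a b))).
rewrite /= big_mkcond [X in X - _ + _]big_mkcond.
rewrite [X in _ - X + _]big_mkcond [X in _ - _ + X]big_mkcond /=.
rewrite -sumrB -big_split /=; apply: eq_bigr => i _.
rewrite ffunE permM block_revK val_block_rev //.
set x := v _; case: (ltnP i a) => ia.
  have -> : (a <= i < b)%N = false by lia.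
  by rewrite /= !ifT ?subrr ?add0r //; lia.
case: (ltnP i b) => ib /=; last first.
  have -> : (a <= i < b)%N = false by lia.
  by rewrite /= !ifF ?subrr ?add0r //; lia.
(* A step inside the block is summed up to [j] after the reversal exactly when it comes at or after
   time [a + b - j] before it. *)
have -> : ((a + b - i).-1 < j)%N = ~~ (i < a + b - j)%N by lia.
have -> : (a <= (a + b - i).-1 < b)%N by lia.
case: (i < a + b - j)%N; rewrite /= sub0r ?addNr // addr0.
by case: (w.2 i); rewrite /= ?expr0 ?expr1 ?mulN1r ?mul1r ?opprK.
Qed.

Lemma signed_path_flip_before (a b : nat) (w : signed_perm) (j : nat) :
  (b <= n)%N -> (j <= a)%N ->
  signed_path v (block_flip a b w) j = signed_path v w j.
Proof.
move=> bn ja; apply: eq_bigr => i ij.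
have rev_i : block_rev a b i = i.
  by apply: val_inj; rewrite /= val_block_rev // ifF //; lia.
by rewrite ffunE permM rev_i; have -> : (a <= i < b)%N = false by lia.
Qed.

End Path.

Definition tie_path : signed_perm -> nat -> int :=
  signed_path (fun i : 'I_n => 2 ^+ i).

(** The increment between two times is a nonempty signed sum of distinct powers of 2. *)
Lemma tie_path_neq (w : signed_perm) (i j : nat) :
  (i <= n)%N -> (j <= n)%N -> i != j -> tie_path w i != tie_path w j.
Proof.
wlog ij : i j / (i < j)%N => [wl|] iN jN.
  by rewrite neq_ltn => /orP[] ij; [|rewrite eq_sym]; apply: wl => //; lia.
move=> _; rewrite eq_sym -subr_eq0.
have -> : tie_path w j - tie_path w i =
    \sum_(k < n | (i <= k < j)%N) (-1) ^+ w.2 k * 2 ^+ w.1 k.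
  rewrite /tie_path /signed_path big_mkcond [X in _ - X]big_mkcond -sumrB /=.
  rewrite [RHS]big_mkcond /=; apply: eq_bigr => k _.
  case: (ltnP k i) => ki /=; first by rewrite ifT ?subrr //; lia.
  by rewrite subr0.
have lin : (i < n)%N by lia.
apply: (@signed_pow2_neq0 _ _ _ _ (Ordinal lin)); first by rewrite /= leqnn.
by move=> k l /val_inj/perm_inj.
Qed.

Section LexOrder.
Variables (R : realType) (x : 'I_n -> R).

(* Ties of the real path are broken by a second path, with the steps [2 ^ i],
   which undergoes the same signed permutation and never repeats a value. *)
Definition lex_lt (w : signed_perm) (i j : nat) : bool :=
  (signed_path x w i < signed_path x w j) ||
  ((signed_path x w i == signed_path x w j) && (tie_path w i < tie_path w j)).

Lemma lex_lt_irr (w : signed_perm) : irreflexive (lex_lt w).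
Proof. by move=> i; rewrite /lex_lt !ltxx andbF. Qed.

Lemma lex_lt_trans (w : signed_perm) : transitive (lex_lt w).
Proof.
move=> j i k /orP[ij|/andP[/eqP ij tij]] /orP[jk|/andP[/eqP jk tjk]]; apply/orP.
- by left; exact: lt_trans jk.
- by left; rewrite -jk.
- by left; rewrite ij.
- by right; rewrite ij jk eqxx (lt_trans tij).
Qed.

Lemma lex_lt_total (w : signed_perm) (i j : nat) :
  (i <= n)%N -> (j <= n)%N -> i != j -> lex_lt w i j || lex_lt w j i.
Proof.
move=> iN jN ij; rewrite /lex_lt.
by case: ltgtP => //= _; rewrite -neq_lt tie_path_neq.
Qed.

Lemma lex_lt_flip (a b : nat) (w : signed_perm) (i j : nat) : (a <= b <= n)%N ->
  (a <= i <= b)%N -> (a <= j <= b)%N ->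
  lex_lt (block_flip a b w) i j = lex_lt w (a + b - i)%N (a + b - j)%N.
Proof.
move=> abn ib jb; rewrite /lex_lt /tie_path !signed_path_flip; try lia.
by rewrite !ltrD2l (inj_eq (addrI _)).
Qed.

Lemma lex_lt_flip_before (a b : nat) (w : signed_perm) (i j : nat) :
  (a <= b <= n)%N -> (i <= a)%N -> (j <= a)%N ->
  lex_lt (block_flip a b w) i j = lex_lt w i j.
Proof.
by move=> abn ia ja; rewrite /lex_lt /tie_path !signed_path_flip_before; try lia.
Qed.

Definition strictly_persistent (w : signed_perm) : bool :=
  [forall k : 'I_n, 0 < signed_path x w k.+1].

Definition weakly_persistent (w : signed_perm) : bool :=
  [forall k : 'I_n, 0 <= signed_path x w k.+1].

Lemma signed_path0 (w : signed_perm) : signed_path x w 0 = 0.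
Proof. by rewrite /signed_path big_pred0. Qed.

Lemma card_lex_persistent :
  #|[set w : signed_perm | ismin n lex_lt w 0 n 0]%SET|%:R =
  central_ratio R n * #|{: signed_perm}|%:R.
Proof.
have := @card_ismin_left R _ n lex_lt block_flip lex_lt_irr lex_lt_trans
  lex_lt_total _ lex_lt_flip lex_lt_flip_before n 0 [set: signed_perm] (leqnn n).
rewrite add0n cardsT => <- //; last by move=> a b /andP[_]; exact: block_flip_inj.
by congr _%:R; apply: eq_card => w; rewrite !inE.
Qed.

(** A strict inequality on the real path decides the lexicographic order, so strict persistence
    forces the lexicographic minimum to be at time 0. *)
Lemma card_strictly_persistent :
  #|[set w | strictly_persistent w]%SET|%:R <=
  central_ratio R n * #|{: signed_perm}|%:R.
Proof.
rewrite -card_lex_persistent ler_nat; apply/subset_leq_card/fintype.subsetP => w.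
rewrite !inE => /forallP pos; apply/isminP => // -[|i] // iN _.
by rewrite /lex_lt signed_path0 (pos (Ordinal iN)).
Qed.

(** The lexicographic order refines the weak order of the real values, so a lexicographic minimum at
    time 0 forces weak persistence. *)
Lemma card_weakly_persistent :
  central_ratio R n * #|{: signed_perm}|%:R <=
  #|[set w | weakly_persistent w]%SET|%:R.
Proof.
rewrite -card_lex_persistent ler_nat; apply/subset_leq_card/fintype.subsetP => w.
rewrite !inE => /(isminP _ _ _ _ (leqnn n)) wmin; apply/forallP => k.
have := wmin k.+1 (ltn_ord k) isT; rewrite /lex_lt signed_path0.
by move=> /orP[/ltW //|/andP[/eqP <-]].
Qed.

End LexOrder.
End SignedPermutations.

(** * Averaging the counts over the probability space *)

(** Linearity of expectation: the integrand counts the events that occur at [w]. Pointwise bounds on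
    this count then bound the sum of the probabilities, as [P] has mass one. *)
Lemma sum_probability (d : measure_display) (T : measurableType d)
    (R : realType) (P : probability T R) (I : finType) (E : I -> set T) :
  (forall i, measurable (E i)) ->
  (\sum_i P (E i) = \int[P]_w (\sum_i \1_(E i) w : R)%:E)%E.
Proof.
move=> mE; under [RHS]eq_integral => w _ do rewrite -sumEFin.
rewrite ge0_integral_sum //.
- by apply: eq_bigr => i _; rewrite integral_indic // setIT.
- by move=> i; apply/measurable_EFinP; exact: measurable_indic.
Qed.

Lemma measurable_sum_indic (d : measure_display) (T : measurableType d)
    (R : realType) (I : finType) (E : I -> set T) :
  (forall i, measurable (E i)) ->
  measurable_fun setT (fun w => (\sum_i \1_(E i) w : R)%:E).
Proof.
move=> mE; apply/measurable_EFinP; apply: measurable_sum => i.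
exact: measurable_indic.
Qed.

Lemma sum_probability_le (d : measure_display) (T : measurableType d)
    (R : realType) (P : probability T R) (I : finType) (E : I -> set T) (c : R) :
  (forall i, measurable (E i)) -> (forall w, \sum_i \1_(E i) w <= c) ->
  (\sum_i P (E i) <= c%:E)%E.
Proof.
move=> mE Ec; rewrite sum_probability //.
have -> : c%:E = (\int[P]_w (cst c%:E) w)%E.
  by rewrite integral_cst // [X in (_ * X)%E](probability_setT P) mule1.
apply: ge0_le_integral => //.
- by move=> w _; rewrite lee_fin; apply: sumr_ge0.
- exact: measurable_sum_indic.
- by move=> w _; rewrite lee_fin.
Qed.

Lemma sum_probability_ge (d : measure_display) (T : measurableType d)
    (R : realType) (P : probability T R) (I : finType) (E : I -> set T) (c : R) :
  0 <= c ->
  (forall i, measurable (E i)) -> (forall w, c <= \sum_i \1_(E i) w) ->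
  (c%:E <= \sum_i P (E i))%E.
Proof.
move=> c0 mE Ec; rewrite sum_probability //.
have -> : c%:E = (\int[P]_w (cst c%:E) w)%E.
  by rewrite integral_cst // [X in (_ * X)%E](probability_setT P) mule1.
apply: ge0_le_integral => //.
- exact: measurable_sum_indic.
- by move=> w _; rewrite lee_fin.
Qed.

Section Persistence.
Variables (d : measure_display) (T : measurableType d) (R : realType).
Variables (P : probability T R) (n : nat) (xi : 'I_n -> {RV P >-> R}).

(** The weights [e] allow signs to be read either as part of the event or as part of the random
    vector. *)
Definition tuple_event (B : set R) (e : 'I_n -> R) : set (n.-tuple R) :=
  [set t | forall k, (1 <= k <= n)%N ->
    B (\sum_(i < n | (i < k)%N) e i * tnth t i)].

Lemma tuple_eventE (B : set R) (e y : 'I_n -> R) :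
  tuple_event B e [tuple y i | i < n] =
  (forall k, (1 <= k <= n)%N -> B (\sum_(i < n | (i < k)%N) e i * y i)).
Proof.
apply: eq_forall => k; congr (_ -> B _); apply: eq_bigr => i _.
by rewrite tnth_mktuple.
Qed.

Lemma measurable_tuple_event (B : set R) (e : 'I_n -> R) :
  measurable B -> measurable (tuple_event B e).
Proof.
move=> mB; rewrite (_ : tuple_event B e = \bigcap_(k in [set k | (1 <= k <= n)%N])
   ((fun t => \sum_(i < n) (if (i < k)%N then e i * tnth t i else 0)) @^-1` B)).
  apply: bigcap_measurableType => k _; rewrite -[X in measurable X]setTI.
  apply: measurable_sum => // i; case: (i < k)%N => //.
  by apply: measurable_funM => //; exact: measurable_tnth.
by apply/seteqP; split => t tB k kn; have := tB k kn; rewrite /= -big_mkcond.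
Qed.

Definition path_event (B : set R) : set T :=
  [set w | forall k, (1 <= k <= n)%N -> B (partial_sum xi k w)].

Definition signed_event (B : set R) (v : signed_perm n) : set T :=
  [set w | forall k, (1 <= k <= n)%N -> B (signed_path (fun i => xi i w) v k)].

Lemma measurable_signed_event (B : set R) (v : signed_perm n) :
  measurable B -> measurable (signed_event B v).
Proof.
move=> mB; rewrite (_ : signed_event B v =
  (fun w => [tuple xi (v.1 i) w | i < n]) @^-1` tuple_event B (fun i => (-1) ^+ v.2 i)).
  have mxi : measurable_fun setT (fun w => [tuple xi (v.1 i) w | i < n]).
    apply/measurable_fun_tnthP => i; rewrite (_ : _ \o _ = xi (v.1 i)) //.
    by apply/funext => w /=; rewrite tnth_mktuple.
  rewrite -[X in measurable X]setTI; apply: mxi => //.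
  exact: measurable_tuple_event.
by apply/funext => w; rewrite /preimage /mkset tuple_eventE.
Qed.

Hypothesis xi_exch : exchangeable P xi.
Hypothesis xi_sign : sign_invariant P xi.

Lemma probability_signed_event (B : set R) (v : signed_perm n) :
  measurable B -> P (signed_event B v) = P (path_event B).
Proof.
move=> mB; pose e i : R := (-1) ^+ v.2 i.
have -> : P (signed_event B v) =
    joint_law P (fun i => xi (v.1 i)) (tuple_event B e).
  by congr (P _); apply/funext => w; rewrite /preimage /mkset tuple_eventE.
(* With the signs kept in the event, exchangeability removes the permutation. The signs then move to
   the vector, where sign invariance removes them. *)
rewrite xi_exch; last exact: measurable_tuple_event.
have -> : joint_law P xi (tuple_event B e) =
    joint_law P (fun i w => e i * xi i w) (tuple_event B (fun=> 1)).
  congr (P _); apply/funext => w; rewrite /preimage /mkset !tuple_eventE.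
  apply: eq_forall => k; congr (_ -> B _); apply: eq_bigr => i _.
  by rewrite mul1r.
rewrite xi_sign; last exact: measurable_tuple_event; last first.
  by move=> i; rewrite /e; case: (v.2 i); [right|left].
congr (P _); apply/funext => w; rewrite /preimage /mkset tuple_eventE.
apply: eq_forall => k; congr (_ -> B _); apply: eq_bigr => i _.
by rewrite mul1r.
Qed.

Lemma sum_probability_signed_event (B : set R) : measurable B ->
  (\sum_v P (signed_event B v) =
   #|{: signed_perm n}|%:R%:E * P (path_event B))%E.
Proof.
move=> mB; under eq_bigr => v _ do rewrite probability_signed_event //.
by rewrite sumr_const mule_natl.
Qed.

Lemma sum_indic_signed_event (B : set R) (p : pred (signed_perm n)) (w : T) :
  (forall v, signed_event B v w <-> p v) ->
  \sum_v \1_(signed_event B v) w = #|[set v | p v]%SET|%:R :> R.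
Proof.
move=> Bp; rewrite -sum1_card natr_sum [RHS]big_mkcond /=.
apply: eq_bigr => v _; rewrite indicE !inE.
have [pv|pv] := boolP (p v); first by rewrite mem_set //; exact/Bp.
by rewrite memNset // => /Bp; exact/negP.
Qed.

Lemma card_signed_perm_gt0 : 0 < #|{: signed_perm n}|%:R :> R.
Proof. by rewrite ltr0n; apply/card_gt0P; exists (1%g, [ffun=> true]). Qed.

Lemma signed_event_strict (w : T) (v : signed_perm n) :
  signed_event [set x | 0 < x] v w <->
  strictly_persistent (fun i => xi i w) v.
Proof.
split=> [wB|/forallP vw k kn]; first by apply/forallP => k; exact: wB k.+1 (ltn_ord k).
have kn' : (k.-1 < n)%N by lia.
by have := vw (Ordinal kn'); rewrite /= prednK //; lia.
Qed.

Lemma signed_event_weak (w : T) (v : signed_perm n) :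
  signed_event [set x | 0 <= x] v w <->
  weakly_persistent (fun i => xi i w) v.
Proof.
split=> [wB|/forallP vw k kn]; first by apply/forallP => k; exact: wB k.+1 (ltn_ord k).
have kn' : (k.-1 < n)%N by lia.
by have := vw (Ordinal kn'); rewrite /= prednK //; lia.
Qed.

Lemma measurable_positive : measurable [set x : R | 0 < x].
Proof. by rewrite -set_itvoy. Qed.

Lemma measurable_nonnegative : measurable [set x : R | 0 <= x].
Proof. by rewrite -set_itvcy. Qed.

(** After multiplication by the number of signed permutations, the left side is the sum of the
    probabilities of all signed events; the number of those that occur at a given [w] is bounded by
    [card_strictly_persistent]. *)
Lemma strict_persistence_le :
  (P (path_event [set x | 0 < x]%R) <= (central_ratio R n)%:E)%E.
Proof.
rewrite -(@lee_pmul2l _ #|{: signed_perm n}|%:R%:E) ?lte_fin ?card_signed_perm_gt0 //.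
rewrite -sum_probability_signed_event; last exact: measurable_positive.
rewrite -EFinM mulrC; apply: sum_probability_le => [v|w].
  by apply: measurable_signed_event; exact: measurable_positive.
by rewrite (sum_indic_signed_event (signed_event_strict w)) card_strictly_persistent.
Qed.

Lemma weak_persistence_ge :
  ((central_ratio R n)%:E <= P (path_event [set x | 0 <= x]%R))%E.
Proof.
rewrite -(@lee_pmul2l _ #|{: signed_perm n}|%:R%:E) ?lte_fin ?card_signed_perm_gt0 //.
rewrite -sum_probability_signed_event; last exact: measurable_nonnegative.
rewrite -EFinM mulrC; apply: sum_probability_ge => [|v|w].
- by rewrite mulr_ge0 ?ler0n // divr_ge0 ?exprn_ge0 ?ler0n.
- by apply: measurable_signed_event; exact: measurable_nonnegative.
by rewrite (sum_indic_signed_event (signed_event_weak w)) card_weakly_persistent.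
Qed.

End Persistence.

(** * Partial sums without an atom at zero *)

Section NoAtom.
Variables (d : measure_display) (T : measurableType d) (R : realType).
Variables (P : probability T R) (n : nat) (xi : 'I_n -> {RV P >-> R}).

Lemma measurable_partial_sum (k : nat) :
  measurable_fun setT (partial_sum xi k).
Proof.
rewrite (_ : partial_sum xi k =
  fun w => \sum_(i < n) (if (i < k)%N then xi i w else 0)).
  by apply: measurable_sum => i; case: (i < k)%N.
by apply/funext => w; rewrite -big_mkcond.
Qed.

Lemma measurable_path_event (B : set R) :
  measurable B -> measurable (path_event xi B).
Proof.
move=> mB; rewrite (_ : path_event xi B =
  \bigcap_(k in [set k | (1 <= k <= n)%N]) (partial_sum xi k @^-1` B)) //.
apply: bigcap_measurableType => k _; rewrite -[X in measurable X]setTI.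
exact: measurable_partial_sum.
Qed.

(** A weakly but not strictly persistent path has some vanishing partial sum, hence lies in the null
    set [N], a finite union of null sets. *)
Lemma weak_persistence_le_strict : partial_sums_no_atom0 P xi ->
  (P (path_event xi [set x | 0 <= x]%R) <= P (path_event xi [set x | 0 < x]%R))%E.
Proof.
move=> no_atom.
pose N := \bigcup_(k in [set k | (1 <= k <= n)%N]) (partial_sum xi k @^-1` [set 0]).
have mF k : measurable (partial_sum xi k @^-1` [set 0]).
  by rewrite -[X in measurable X]setTI; apply: measurable_partial_sum.
have mN : measurable N by apply: bigcup_measurable => k _; exact: mF.
have N0 : P N = 0%E.
  apply: measure_negligible => //.
  rewrite /N bigcup_mkcond; apply: negligible_bigcup => k.
  case: ifPn => [/set_mem kn|_]; last exact: negligible_set0.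
  by apply/negligibleP => //; exact: no_atom.
rewrite -(measureU0 (measurable_path_event (@measurable_positive R)) mN N0).
apply: le_measure; rewrite ?inE.
- by apply: measurable_path_event; exact: measurable_nonnegative.
- by apply: measurableU => //; apply: measurable_path_event; exact: measurable_positive.
move=> w w_ge0; have [wN|wN] := pselect (N w); [by right|left => k kn].
have := w_ge0 k kn; rewrite /= le_eqVlt => /orP[/eqP Sk0|//].
by case: wN; exists k.
Qed.

End NoAtom.

Theorem theorem2p1 (d : measure_display) (T : measurableType d) (R : realType)
    (P : probability T R) (n : nat) (n_ge1 : (1 <= n)%N)
    (xi : 'I_n -> {RV P >-> R})
    (xi_exch : exchangeable P xi) (xi_sign : sign_invariant P xi) :
  [/\ (P [set w | forall k : nat, (1 <= k <= n)%N -> (0 < partial_sum xi k w)%R]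
         <= (central_ratio R n)%:E)%E,
      ((central_ratio R n)%:E
         <= P [set w | forall k : nat, (1 <= k <= n)%N -> (0 <= partial_sum xi k w)%R])%E
    & partial_sums_no_atom0 P xi ->
      P [set w | forall k : nat, (1 <= k <= n)%N -> (0 < partial_sum xi k w)%R]
        = (central_ratio R n)%:E
      /\ (central_ratio R n)%:E
        = P [set w | forall k : nat, (1 <= k <= n)%N -> (0 <= partial_sum xi k w)%R]].
Proof.
have strict_le := strict_persistence_le xi_exch xi_sign.
have weak_ge := weak_persistence_ge xi_exch xi_sign.
(* Without an atom at 0, [weak_le] closes the chain strict, ratio, weak into a cycle of
   inequalities. *)
split=> // /weak_persistence_le_strict weak_le.
split; apply/eqP; rewrite eq_le.
  by apply/andP; split; last exact: le_trans weak_le.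
by apply/andP; split; last exact: le_trans strict_le.
Qed.
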